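(* Suppose $\mathcal{Y}=\mathbb{R}^n$, and each $f_i$ is strongly convex with constant $\mu_i>0$ and differentiable with $\nabla f_i$ Lipschitz continuous on $\mathbb{R}^n$ with constant $L_i>0$, $i=1,\dots,m$. Let $\mu=\min_i\mu_i$, $L=\max_iL_i$, $L_h=(1/\mu)(2+2\cos(\pi/m))$, $\mu_h=(1/L)(2-2\cos(\pi/m))$, $h=-g$, and let $\boldsymbol{\lambda}^\star$ be a dual optimal solution, i.e. a maximizer of $g$. Let $\{\boldsymbol{\lambda}^{(k)}\}_{k\ge0}$ be generated by the inexact dual algorithm with distortions satisfying $\|\mathbf{r}_i^{(k)}\|\le\varepsilon_i$ for all $i,k$ and with stepsizes satisfying $0<\gamma_k\le1/L_h$ for all $k\ge0$ and $\sum_{k=0}^\infty\gamma_k=\infty$. Then: 1. $\displaystyle\limsup_k\ \big(h(\boldsymbol{\lambda}^{(k)})-h(\boldsymbol{\lambda}^\star)\big)\le\frac{\epsilon^2}{2\mu_h}$. 2. If $\gamma_k=(c/\mu_h)/(k+1)^p$ with $0<p\le1$ and $0<c\le\mu_h/L_h$, then there is a constant $C$ (independent of $k$) such that for all sufficiently large $k$, $$h(\boldsymbol{\lambda}^{(k)})-h(\boldsymbol{\lambda}^\star)\le\frac{C}{k^{c/p}}+\frac{\epsilon^2}{2\mu_h}.$$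
   Context: Let $m\ge2$, $n\ge1$ be integers, $\mathcal{Y}\subseteq\mathbb{R}^n$ a closed convex set, and $f_i:\mathbb{R}^n\to\mathbb{R}$, $i=1,\dots,m$, strictly convex closed functions. For $\mathbf{y}=(\mathbf{y}_1,\dots,\mathbf{y}_m)\in(\mathbb{R}^n)^m=\mathbb{R}^{nm}$ put $f(\mathbf{y})=\sum_{i=1}^m f_i(\mathbf{y}_i)$, let $\bar{\mathcal{Y}}=\mathcal{Y}^m$, and $\mathbf{A}\mathbf{y}=(\mathbf{y}_1-\mathbf{y}_2,\dots,\mathbf{y}_{m-1}-\mathbf{y}_m)\in\mathbb{R}^{n(m-1)}$. The dual function is $g(\boldsymbol{\lambda})=\inf_{\mathbf{y}\in\bar{\mathcal{Y}}}\big[f(\mathbf{y})+\boldsymbol{\lambda}^{T}\mathbf{A}\mathbf{y}\big]$, $\boldsymbol{\lambda}\in\mathbb{R}^{n(m-1)}$. Inexact dual algorithm: start from any $\boldsymbol{\lambda}^{(0)}\in\mathbb{R}^{n(m-1)}$; for $k=0,1,2,\dots$ let $\mathbf{y}^{(k)}=\arg\min_{\mathbf{y}\in\bar{\mathcal{Y}}}\big[f(\mathbf{y})+(\boldsymbol{\lambda}^{(k)})^{T}\mathbf{A}\mathbf{y}\big]$, let $\hat{\mathbf{y}}_i^{(k)}=\mathbf{y}_i^{(k)}+\mathbf{r}_i^{(k)}$ where $\mathbf{r}_i^{(k)}\in\mathbb{R}^n$ are arbitrary distortions, let $\hat{\mathbf{d}}^{(k)}=\mathbf{A}\hat{\mathbf{y}}^{(k)}$,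 and set $\boldsymbol{\lambda}^{(k+1)}=\boldsymbol{\lambda}^{(k)}+\gamma_k\hat{\mathbf{d}}^{(k)}$. The distortions are bounded by constants: $\|\mathbf{r}_i^{(k)}\|\le\varepsilon_i$ for all $i$ and $k$, and $\epsilon:=\sqrt{\sum_{i=1}^{m-1}(\varepsilon_i+\varepsilon_{i+1})^2}$. Norms are Euclidean. A function $\varphi$ is strongly convex with constant $\sigma>0$ if $\varphi-\frac{\sigma}{2}\|\cdot\|^2$ is convex. *)

(* Defs.v *)
From HB Require Import structures.
From mathcomp Require Import all_boot all_order all_algebra.
From mathcomp Require Import all_classical all_reals all_analysis.

Set Implicit Arguments.
Unset Strict Implicit.
Unset Printing Implicit Defensive.

Import Order.TTheory GRing.Theory Num.Theory.
Import numFieldNormedType.Exports.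

Local Open Scope classical_set_scope.
Local Open Scope ring_scope.

(* The canonical norm of MathComp-Analysis on matrices is the sup norm, hence
   the explicit Euclidean inner product and norm below.  A block vector
   (y_1, ..., y_m) of (R^n)^m is the m x n matrix whose i-th row is y_i, so that
   [dotprod] and [enorm] are also the inner product and norm of R^(nm). *)
Definition dotprod (R : realType) (p n : nat) (u v : 'M[R]_(p, n)) : R :=
  \sum_(i < p) \sum_(j < n) u i j * v i j.

Definition enorm (R : realType) (p n : nat) (u : 'M[R]_(p, n)) : R :=
  Num.sqrt (dotprod u u).

Definition strictly_convex (R : realType) (n : nat) (f : 'rV[R]_n -> R) : Prop :=
  forall (x y : 'rV[R]_n) (t : R), x != y -> 0 < t -> t < 1 ->
    f (t *: x + (1 - t) *: y) < t * f x + (1 - t) * f y.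

Definition closed_function (R : realType) (n : nat) (f : 'rV[R]_n -> R) : Prop :=
  closed [set z : 'rV[R]_n * R | f z.1 <= z.2].

Definition strongly_convex (R : realType) (n : nat) (sigma : R)
    (f : 'rV[R]_n -> R) : Prop :=
  @convex_function R 'rV[R]_n setT
    (fun x => f x - sigma / 2 * enorm x ^+ 2).

Definition gradient (R : realType) (n : nat) (f : 'rV[R]_n -> R)
    (x : 'rV[R]_n) : 'rV[R]_n :=
  \row_(j < n) 'D_(delta_mx 0 j) f x.

Definition lipschitz_gradient (R : realType) (n : nat) (L : R)
    (f : 'rV[R]_n -> R) : Prop :=
  forall x y : 'rV[R]_n,
    enorm (gradient f x - gradient f y) <= L * enorm (x - y).

Lemma ord_next_subproof (m : nat) (i : 'I_m.-1) : (i.+1 < m)%N.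
Proof. by rewrite -ltn_predRL. Qed.

(* For i < m - 1, the indices i and i + 1 seen as elements of 'I_m. *)
Definition ord_here (m : nat) (i : 'I_m.-1) : 'I_m := widen_ord (leq_pred m) i.
Definition ord_next (m : nat) (i : 'I_m.-1) : 'I_m :=
  Ordinal (ord_next_subproof i).

Definition consensus_op (R : realType) (m n : nat) (y : 'M[R]_(m, n)) :
    'M[R]_(m.-1, n) :=
  \matrix_(i < m.-1) (row (ord_here i) y - row (ord_next i) y).

Definition block_set (R : realType) (m n : nat) (Y : set 'rV[R]_n) :
    set 'M[R]_(m, n) :=
  [set y | forall i, Y (row i y)].

Definition lagrangian (R : realType) (m n : nat) (f : 'I_m -> 'rV[R]_n -> R)
    (lam : 'M[R]_(m.-1, n)) (y : 'M[R]_(m, n)) : R :=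
  \sum_(i < m) f i (row i y) + dotprod lam (consensus_op y).

(* Extended-real valued, since the infimum may be -oo in general. *)
Definition dual_fun (R : realType) (m n : nat) (Y : set 'rV[R]_n)
    (f : 'I_m -> 'rV[R]_n -> R) (lam : 'M[R]_(m.-1, n)) : \bar R :=
  ereal_inf [set (lagrangian f lam y)%:E | y in block_set Y].

Definition is_argmin (R : realType) (T : Type) (D : set T) (F : T -> R) (y : T) :
    Prop :=
  D y /\ forall z, D z -> F y <= F z.

(* [lam 0] is unconstrained: the initial point is arbitrary.  The i-th row of
   [r k] is the distortion of the i-th block at iteration k. *)
Definition inexact_dual_algorithm (R : realType) (m n : nat) (Y : set 'rV[R]_n)
    (f : 'I_m -> 'rV[R]_n -> R) (gamma : nat -> R)
    (r y : nat -> 'M[R]_(m, n)) (lam : nat -> 'M[R]_(m.-1, n)) : Prop :=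
  forall k : nat,
    is_argmin (block_set Y) (lagrangian f (lam k)) (y k) /\
    lam k.+1 = lam k + gamma k *: consensus_op (y k + r k).

Definition total_distortion (R : realType) (m : nat) (e : 'I_m -> R) : R :=
  Num.sqrt (\sum_(i < m.-1) (e (ord_here i) + e (ord_next i)) ^+ 2).

(* Minimum and maximum of a nonempty finite family; the initial value of the
   iterated operation is a member of the family. *)
Definition family_min (R : realType) (m : nat) (hm : (2 <= m)%N)
    (F : 'I_m -> R) : R :=
  \big[Num.min/F (Ordinal (ltnW hm))]_(i < m) F i.

Definition family_max (R : realType) (m : nat) (hm : (2 <= m)%N)
    (F : 'I_m -> R) : R :=
  \big[Num.max/F (Ordinal (ltnW hm))]_(i < m) F i.

(* Main.v *)
(* Strong convexity and smoothness of the primal blocks give quadratic lower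
   and upper bounds on the Lagrangian around its minimizer [y].  Through the
   adjoint of the consensus operator, whose singular values are controlled by
   the spectrum of the path graph, they become dual bounds: with
   [q := consensus_op y], a quadratic minorant of [g] of curvature [L_h], and
   the Polyak-Lojasiewicz inequality [g* - g l <= |q|^2 / (2 mu_h)].  An inexact
   ascent step then contracts [g* - g l - eps^2 / (2 mu_h)] by the factor
   [1 - mu_h * gamma], and both claims follow by estimating the product of these
   factors. *)

Require Import Defs.
From HB Require Import structures.
From mathcomp Require Import all_boot all_order all_algebra.
From mathcomp Require Import all_classical all_reals all_analysis.
From mathcomp Require Import ring lra.

Set Implicit Arguments.
Unset Strict Implicit.
Unset Printing Implicit Defensive.

Import Order.TTheory GRing.Theory Num.Theory.
Import numFieldNormedType.Exports.

Local Open Scope classical_set_scope.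
Local Open Scope ring_scope.

Section InnerProduct.
Variables (R : realType) (p n : nat).
Implicit Types u v w : 'M[R]_(p, n).

Lemma dotprodC u v : dotprod u v = dotprod v u.
Proof. by apply: eq_bigr => i _; apply: eq_bigr => j _; rewrite mulrC. Qed.

Lemma dotprodDl u v w : dotprod (u + v) w = dotprod u w + dotprod v w.
Proof.
rewrite /dotprod -big_split; apply: eq_bigr => i _ /=.
by rewrite -big_split; apply: eq_bigr => j _; rewrite mxE mulrDl.
Qed.

Lemma dotprodZl a u v : dotprod (a *: u) v = a * dotprod u v.
Proof.
rewrite /dotprod mulr_sumr; apply: eq_bigr => i _.
by rewrite mulr_sumr; apply: eq_bigr => j _; rewrite mxE mulrA.
Qed.

Lemma dotprodDr u v w : dotprod u (v + w) = dotprod u v + dotprod u w.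
Proof. by rewrite dotprodC dotprodDl !(dotprodC u). Qed.

Lemma dotprodZr a u v : dotprod u (a *: v) = a * dotprod u v.
Proof. by rewrite dotprodC dotprodZl dotprodC. Qed.

Lemma dotprodNl u v : dotprod (- u) v = - dotprod u v.
Proof. by rewrite -scaleN1r dotprodZl mulN1r. Qed.

Lemma dotprodNr u v : dotprod u (- v) = - dotprod u v.
Proof. by rewrite dotprodC dotprodNl dotprodC. Qed.

Lemma dotprodv_ge0 u : 0 <= dotprod u u.
Proof. by apply: sumr_ge0 => i _; apply: sumr_ge0 => j _; exact: sqr_ge0. Qed.

Lemma enorm_sqr u : enorm u ^+ 2 = dotprod u u.
Proof. by rewrite sqr_sqrtr ?dotprodv_ge0. Qed.

Lemma enorm_ge0 u : 0 <= enorm u.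
Proof. exact: sqrtr_ge0. Qed.

Lemma dotprod_le_enorm u v : dotprod u v <= enorm u * enorm v.
Proof.
have h : dotprod u v ^+ 2 <= dotprod u u * dotprod v v.
  have [u0|u0] := eqVneq (dotprod u u) 0.
    have -> : dotprod u v = 0; last by rewrite u0 expr0n mul0r.
    rewrite /dotprod big1 // => i _; rewrite big1 // => j _.
    suff -> : u i j = 0 by rewrite mul0r.
    apply/eqP; rewrite -sqrf_eq0 expr2.
    have rows_ge0 i' : true -> 0 <= \sum_j' u i' j' * u i' j'.
      by move=> _; apply: sumr_ge0 => k _; exact: sqr_ge0.
    have := psumr_eq0P rows_ge0 u0 (erefl true) => /(_ i) ui.
    have := psumr_eq0P (fun j' (_ : true) => sqr_ge0 (u i j')) ui.
    by move=> /(_ j (erefl true)) /eqP.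
  have up : 0 < dotprod u u by rewrite lt_neqAle eq_sym u0 dotprodv_ge0.
  rewrite -(ler_pM2l up) -subr_ge0.
  have := mulr_ge0 (ltW up)
    (dotprodv_ge0 (dotprod u u *: v - dotprod u v *: u)).
  rewrite dotprodDl !dotprodDr !dotprodNl !dotprodNr !dotprodZl !dotprodZr.
  rewrite (dotprodC v u).
  set a := dotprod u u; set b := dotprod u v; set c := dotprod v v => h.
  rewrite -(pmulr_rge0 _ up) -/a; congr (0 <= _): h; ring.
rewrite (le_trans (ler_norm _))// -sqrtr_sqr /enorm -sqrtrM ?dotprodv_ge0//.
exact: ler_wsqrtr.
Qed.

Lemma enormD u v : enorm (u + v) <= enorm u + enorm v.
Proof.
rewrite -(@ler_pXn2r _ 2)// ?nnegrE ?addr_ge0 ?enorm_ge0//.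
rewrite sqrrD !enorm_sqr dotprodDl !dotprodDr (dotprodC v u).
have := dotprod_le_enorm u v; lra.
Qed.

Lemma enormN u : enorm (- u) = enorm u.
Proof. by rewrite /enorm dotprodNl dotprodNr opprK. Qed.

Lemma dotprod_row u v : dotprod u v = \sum_i dotprod (row i u) (row i v).
Proof.
apply: eq_bigr => i _; rewrite /dotprod big_ord1.
by apply: eq_bigr => j _; rewrite !mxE.
Qed.

End InnerProduct.

Section Gradient.
Variables (R : realType) (n : nat).
Implicit Types (f : 'rV[R]_n -> R) (x v : 'rV[R]_n).

Lemma derive_gradient f x v :
  differentiable f x -> 'D_v f x = dotprod (gradient f x) v.
Proof.
move=> fx; rewrite deriveE// [in LHS](row_sum_delta v) linear_sum /dotprod.
rewrite big_ord1; apply: eq_bigr => j _.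
by rewrite linearZ /= -deriveE// mxE mulrC.
Qed.

Lemma is_derive_line f x v (t : R) : differentiable f (x + t *: v) ->
  is_derive t 1 (fun s : R => f (x + s *: v)) ('D_v f (x + t *: v)).
Proof.
move=> fx; have E : (fun h : R => h^-1 *: (f (x + (h *: 1 + t) *: v) - f (x + t *: v))) =
    (fun h : R => h^-1 *: (f (h *: v + (x + t *: v)) - f (x + t *: v))).
  by apply/funext => h; rewrite scalerDl addrCA [h *: 1]mulr1.
apply: DeriveDef; last by rewrite /derive /= E.
by rewrite /derivable /= E; exact: diff_derivable.
Qed.

Lemma descent_lemma f (L : R) x v :
  (forall z, differentiable f z) -> lipschitz_gradient L f ->
  f (x + v) <= f x + 'D_v f x + L / 2 * dotprod v v.
Proof.
move=> fd fL.
pose phi t := f (x + t *: v) - t * 'D_v f x - t ^+ 2 * (L / 2 * dotprod v v).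
have dphi (t : R) : is_derive t 1 phi
    ('D_v f (x + t *: v) - 'D_v f x - t * (L * dotprod v v)).
  have df := is_derive_line (fd (x + t *: v)).
  have -> : phi = (fun s => f (x + s *: v)) - ('D_v f x \*: id)
      - ((L / 2 * dotprod v v) \*: (id ^+ 2 : R -> R)).
    apply/funext => s; rewrite /phi !fctE /= /GRing.scale /=; ring.
  by apply: is_derive_eq; rewrite /GRing.scale /=; field.
have phi_nincr : phi 1 <= phi 0.
  apply: (@ler0_derive1_nincr _ phi 0 1) => //.
  - move=> t; rewrite in_itv /= => /andP[t0 _].
    rewrite derive1E derive_val !derive_gradient// -dotprodNl -dotprodDl.
    have := dotprod_le_enorm (gradient f (x + t *: v) - gradient f x) v.
    have := fL (x + t *: v) x; rewrite addrAC subrr add0r => h1 h2.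
    have h3 : enorm (t *: v) = t * enorm v.
      rewrite /enorm dotprodZl dotprodZr mulrA sqrtrM; last exact: sqr_ge0.
      by rewrite sqrtr_sqr gtr0_norm.
    rewrite subr_le0 (le_trans h2)// (le_trans (ler_wpM2r (enorm_ge0 v) h1))//.
    by rewrite h3 -enorm_sqr; lra.
  - apply: continuous_subspaceT => t; apply: differentiable_continuous.
    by apply/derivable1_diffP; apply: ex_derive.
have := phi_nincr.
by rewrite /phi !(scale0r, scale1r, addr0, expr0n, expr1n) /=; lra.
Qed.

Lemma strongly_convex_line f (sigma : R) x v (t : R) :
  strongly_convex sigma f -> 0 <= t <= 1 ->
  f (x + t *: v) <=
    f x + t * (f (x + v) - f x) - sigma / 2 * (t * (1 - t)) * dotprod v v.
Proof.
move=> fs /andP[t0 t1].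
have := fs (Itv01 t0 t1) (x + v) x.
rewrite !inE => /(_ Logic.I Logic.I) /=.
rewrite convRE /conv /= /unstable.onem.
rewrite (_ : t *: (x + v) + (1 - t) *: x = x + t *: v); last first.
  by rewrite scalerDr addrAC -scalerDl addrC subrKC scale1r addrC.
rewrite !enorm_sqr !dotprodDl !dotprodDr !dotprodZl !dotprodZr (dotprodC v x).
lra.
Qed.

End Gradient.

Lemma sum_by_parts (R : comRingType) (x V : nat -> R) (N : nat) :
  \sum_(i < N.+1) (x i.+1 - x i) * V i =
  x N.+1 * V N - x 0 * V 0 + \sum_(i < N) x i.+1 * (V i - V i.+1).
Proof.
elim: N => [|N IH]; first by rewrite big_ord1 big_ord0; ring.
by rewrite big_ord_recr IH [in RHS]big_ord_recr /=; ring.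
Qed.

Section PathSpectrum.
Variables (R : realType) (m : nat).
Hypothesis hm : (2 <= m)%N.
Let theta : R := pi / m%:R.

Let m_gt0 : 0 < m%:R :> R.
Proof. by rewrite ltr0n (ltn_trans _ hm). Qed.

Let s (i : nat) : R := sin (i%:R * theta).

Let s_gt0 i : (0 < i < m)%N -> 0 < s i.
Proof.
move=> /andP[i0 im]; apply: sin_gt0_pi; apply/andP; split.
  by rewrite mulr_gt0 ?ltr0n// divr_gt0 ?pi_gt0.
by rewrite /theta mulrCA gtr_pMr ?pi_gt0// ltr_pdivrMr// mul1r ltr_nat.
Qed.

Let s_rec i : s i + s i.+2 = 2 * cos theta * s i.+1.
Proof.
have -> : s i = sin (i.+1%:R * theta - theta).
  by rewrite /s; congr sin; rewrite -[in RHS]natr1; ring.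
have -> : s i.+2 = sin (i.+1%:R * theta + theta).
  by rewrite /s; congr sin; rewrite -[in LHS]natr1; ring.
by rewrite /s !sinD cosN sinN; ring.
Qed.

Lemma cos_pi_div_bounds : 0 <= cos theta < 1.
Proof.
have theta_gt0 : 0 < theta by rewrite divr_gt0 ?pi_gt0.
have m2 : 2 <= m%:R :> R by rewrite ler_nat.
apply/andP; split.
  apply: cos_ge0_pihalf; apply/andP; split.
    by rewrite (le_trans _ (ltW theta_gt0))// oppr_le0 divr_ge0// pi_ge0.
  by rewrite ler_pM2l ?pi_gt0// lef_pV2 ?posrE.
have /s_gt0 : (0 < 1 < m)%N by [].
rewrite /s mul1r => st; rewrite lt_neqAle cos_le1 andbT.
apply/eqP => c1; have := cos2Dsin2 theta; rewrite c1; nra.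
Qed.

(* [s] is a positive eigenvector of the path adjacency matrix, for the
   eigenvalue [2 * cos theta]; AM-GM with weights [s i.+1 / s i] then bounds
   the quadratic form. *)
Lemma path_form_le (a : R) (x : nat -> R) : a ^+ 2 = 1 -> x 0%N = 0 -> x m = 0 ->
  2 * a * (\sum_(i < m) x i * x i.+1) <=
  2 * cos theta * \sum_(i < m) x i ^+ 2.
Proof.
move=> a2 x0 xm.
have claim k : (k.+1 < m)%N -> 2 * a * (\sum_(i < k.+1) x i * x i.+1) <=
    2 * cos theta * (\sum_(i < k.+1) x i ^+ 2) + s k / s k.+1 * x k.+1 ^+ 2.
  elim: k => [|k IH] km.
    rewrite !big_ord1 x0 /s !mul0r sin0; lra.
  rewrite !(big_ord_recr k.+1) /=.
  have s1 : 0 < s k.+1 by apply: s_gt0; rewrite (ltn_trans _ km).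
  have s2 : 0 < s k.+2 by apply: s_gt0; rewrite km.
  have cE : 2 * cos theta * x k.+1 ^+ 2 =
      s k / s k.+1 * x k.+1 ^+ 2 + s k.+2 / s k.+1 * x k.+1 ^+ 2.
    by rewrite -mulrDl -mulrDl s_rec mulfK// gt_eqF.
  have amgm : 2 * a * (x k.+1 * x k.+2) <=
      s k.+2 / s k.+1 * x k.+1 ^+ 2 + s k.+1 / s k.+2 * x k.+2 ^+ 2.
    rewrite -subr_ge0.
    have -> : s k.+2 / s k.+1 * x k.+1 ^+ 2 + s k.+1 / s k.+2 * x k.+2 ^+ 2
        - 2 * a * (x k.+1 * x k.+2)
        = (s k.+2 * x k.+1 - a * s k.+1 * x k.+2) ^+ 2 / (s k.+1 * s k.+2).
      rewrite sqrrB !exprMn a2; field.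
      by rewrite !gt_eqF.
    by rewrite divr_ge0 ?sqr_ge0// mulr_ge0// ltW.
  by have := IH (ltnW km); lra.
have [k mk] : exists k, m = k.+2.
  by move: hm; case: (m) => [|[|k]] // _; exists k.
have sm : s k.+2 = 0.
  by rewrite /s -mk /theta mulrCA divff ?mulr1 ?sinpi// gt_eqF.
have s1 : 0 < s k.+1 by apply: s_gt0; rewrite mk ltnSn.
rewrite mk !(big_ord_recr k.+1) /= -mk xm mulr0 addr0 mulrDr.
have := claim k; rewrite mk => /(_ (ltnSn _)).
have := s_rec k; rewrite sm addr0 => ->.
by rewrite mulfK ?gt_eqF.
Qed.

Lemma path_laplacian_bounds (x : nat -> R) : x 0%N = 0 -> x m = 0 ->
  (2 - 2 * cos theta) * (\sum_(i < m) x i ^+ 2)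
    <= \sum_(i < m) (x i.+1 - x i) ^+ 2
    <= (2 + 2 * cos theta) * (\sum_(i < m) x i ^+ 2).
Proof.
move=> x0 xm.
have shift : \sum_(i < m) x i.+1 ^+ 2 = \sum_(i < m) x i ^+ 2.
  apply: (@addrI _ (x 0%N ^+ 2)); rewrite -(big_ord_recl m (fun i => x i ^+ 2)).
  by rewrite big_ord_recr /= xm x0 addrC.
have -> : \sum_(i < m) (x i.+1 - x i) ^+ 2 =
    2 * (\sum_(i < m) x i ^+ 2) - 2 * (\sum_(i < m) x i * x i.+1).
  rewrite mulr2n mulrDl mul1r -[in X in X + _ - _]shift -big_split /=.
  rewrite mulr_sumr -sumrB; apply: eq_bigr => i _; ring.
have := @path_form_le 1 x (expr1n _ _) x0 xm.
have := @path_form_le (-1) x (etrans (sqrrN 1) (expr1n _ _)) x0 xm.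
by move=> h1 h2; apply/andP; split; lra.
Qed.

End PathSpectrum.

Section Consensus.
Variables (R : realType) (m n : nat).
Implicit Types (w : 'M[R]_(m.-1, n)) (u v : 'M[R]_(m, n)).

Lemma consensus_opD u v :
  consensus_op (u + v) = consensus_op u + consensus_op v.
Proof. by apply/matrixP => i j; rewrite !mxE; ring. Qed.

Lemma consensus_opZ a v : consensus_op (a *: v) = a *: consensus_op v.
Proof. by apply/matrixP => i j; rewrite !mxE; ring. Qed.

(* Column [j] of [w], shifted by one and padded with zeros at both ends. *)
Definition padded_col w (j : 'I_n) (k : nat) : R :=
  if k is k'.+1 then oapp (w^~ j) 0 (insub k') else 0.

Definition consensus_adj w : 'M[R]_(m, n) :=
  \matrix_(i, j) (padded_col w j i.+1 - padded_col w j i).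

Lemma padded_colS w j (i : 'I_m.-1) : padded_col w j i.+1 = w i j.
Proof. by rewrite /padded_col valK. Qed.

Hypothesis hm : (2 <= m)%N.

Lemma padded_col_last w j : padded_col w j m = 0.
Proof.
rewrite /padded_col; case: m hm w => [|k] //= _ w.
by rewrite insubF// ltnn.
Qed.

Lemma consensus_adjP w v :
  dotprod w (consensus_op v) = dotprod (consensus_adj w) v.
Proof.
rewrite /dotprod exchange_big [RHS]exchange_big; apply: eq_bigr => j _ /=.
pose V k := oapp (v^~ j) 0 (insub k : option 'I_m).
have VE (i : 'I_m) : v i j = V i by rewrite /V valK.
transitivity (\sum_(i < m) (padded_col w j i.+1 - padded_col w j i) * V i).
  transitivity (\sum_(i < m.-1) padded_col w j i.+1 * (V i - V i.+1)).
    apply: eq_bigr => i _.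
    rewrite padded_colS !mxE (VE (ord_here i)) (VE (ord_next i)).
    by [].
  have mE : m.-1.+1 = m by rewrite prednK// ltnW.
  rewrite -[in RHS]mE sum_by_parts mE padded_col_last.
  by rewrite !mul0r subr0 add0r.
by apply: eq_bigr => i _; rewrite !mxE VE.
Qed.

Lemma consensus_adj_bounds w :
  (2 - 2 * cos (pi / m%:R)) * dotprod w w
    <= dotprod (consensus_adj w) (consensus_adj w)
    <= (2 + 2 * cos (pi / m%:R)) * dotprod w w.
Proof.
have wE : dotprod w w = \sum_j \sum_(i < m) padded_col w j i ^+ 2.
  rewrite /dotprod exchange_big; apply: eq_bigr => j _ /=.
  have mE : m.-1.+1 = m by rewrite prednK// ltnW.
  rewrite -[in RHS]mE big_ord_recl /= expr0n add0r.
  by apply: eq_bigr => i _; rewrite valK.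
have aE : dotprod (consensus_adj w) (consensus_adj w) =
    \sum_j \sum_(i < m) (padded_col w j i.+1 - padded_col w j i) ^+ 2.
  rewrite /dotprod exchange_big; apply: eq_bigr => j _ /=.
  by apply: eq_bigr => i _; rewrite !mxE -expr2.
have b j := path_laplacian_bounds hm (erefl : padded_col w j 0 = 0)
  (padded_col_last w j).
rewrite wE aE !mulr_sumr; apply/andP; split; apply: ler_sum => j _.
  by have /andP[] := b j.
by have /andP[] := b j.
Qed.

Lemma consensus_distortion (e : 'I_m -> R) v :
  (forall i, enorm (row i v) <= e i) ->
  dotprod (consensus_op v) (consensus_op v) <= total_distortion e ^+ 2.
Proof.
move=> ve; rewrite /total_distortion sqr_sqrtr; last first.
  by apply: sumr_ge0 => i _; exact: sqr_ge0.
rewrite dotprod_row; apply: ler_sum => i _.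
rewrite rowK -enorm_sqr lerXn2r ?nnegrE ?enorm_ge0//.
  by rewrite addr_ge0// (le_trans (enorm_ge0 _) (ve _)).
by rewrite (le_trans (enormD _ _))// enormN lerD.
Qed.

End Consensus.

Lemma affine_ge0 (R : realType) (D c : R) :
  (forall t, 0 < t <= 1 -> 0 <= D + t * c) -> 0 <= D.
Proof.
move=> h; rewrite leNgt; apply/negP => D0.
have /h h1 : 0 < (1 : R) <= 1 by rewrite ltr01 lexx.
have c0 : 0 < c by lra.
have /h : 0 < - D / (2 * c) <= 1.
  rewrite divr_gt0 ?mulr_gt0 ?oppr_gt0//=.
  by rewrite ler_pdivrMr ?mulr_gt0//; lra.
have -> : D + - D / (2 * c) * c = D / 2 by field; rewrite gt_eqF.
lra.
Qed.

Section Lagrangian.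
Variables (R : realType) (m n : nat) (f : 'I_m -> 'rV[R]_n -> R).
Variables (mu L : R) (mus Ls : 'I_m -> R).
Hypotheses (hm : (2 <= m)%N) (hn : (1 <= n)%N).
Hypotheses (mu_gt0 : 0 < mu) (mu_le : forall i, mu <= mus i).
Hypotheses (L_gt0 : 0 < L) (Ls_le : forall i, Ls i <= L).
Hypothesis f_strong : forall i, strongly_convex (mus i) (f i).
Hypothesis f_diff : forall i x, differentiable (f i) x.
Hypothesis f_smooth : forall i, lipschitz_gradient (Ls i) (f i).
Implicit Types (l : 'M[R]_(m.-1, n)) (y v : 'M[R]_(m, n)).

Lemma lagrangianDl l l' y :
  lagrangian f l' y = lagrangian f l y + dotprod (l' - l) (consensus_op y).
Proof. by rewrite /lagrangian dotprodDl dotprodNl; ring. Qed.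

Lemma lagrangian_argmin_growth l y v :
  (forall z, lagrangian f l y <= lagrangian f l z) ->
  lagrangian f l y + mu / 2 * dotprod v v <= lagrangian f l (y + v).
Proof.
move=> ymin; rewrite -subr_ge0.
apply: (@affine_ge0 _ _ (mu / 2 * dotprod v v)) => t /andP[t0 t1].
rewrite -(pmulr_rge0 _ t0).
suff : lagrangian f l (y + t *: v) <= lagrangian f l y
    + t * (lagrangian f l (y + v) - lagrangian f l y)
    - mu / 2 * (t * (1 - t)) * dotprod v v.
  by have := ymin (y + t *: v); nra.
have fi i : f i (row i (y + t *: v)) <= f i (row i y)
    + t * (f i (row i (y + v)) - f i (row i y))
    - mu / 2 * (t * (1 - t)) * dotprod (row i v) (row i v).
  rewrite !linearD linearZ /=.
  have t01 : 0 <= t <= 1 by rewrite ltW.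
  apply: (le_trans (strongly_convex_line _ _ (f_strong i) t01)).
  rewrite lerD2l lerN2 ler_wpM2r ?dotprodv_ge0// ler_wpM2r//.
    by rewrite mulr_ge0// ?subr_ge0// ltW.
  by rewrite ler_pM2r.
have := ler_sum (index_enum _) (fun i (_ : true) => fi i).
rewrite /lagrangian !(consensus_opD, consensus_opZ, dotprodDr, dotprodZr).
rewrite !big_split /= sumrN -!mulr_sumr !big_split /= sumrN -dotprod_row.
by move=> h; lra.
Qed.

Lemma lagrangian_argmin_descent l y v :
  (forall z, lagrangian f l y <= lagrangian f l z) ->
  lagrangian f l (y + v) <= lagrangian f l y + L / 2 * dotprod v v.
Proof.
move=> ymin.
pose D u := \sum_i dotprod (gradient (f i) (row i y)) (row i u)
  + dotprod l (consensus_op u).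
have DZ a u : D (a *: u) = a * D u.
  rewrite /D consensus_opZ dotprodZr mulrDr; congr (_ + _).
  by rewrite mulr_sumr; apply: eq_bigr => i _; rewrite linearZ dotprodZr.
have upper u : lagrangian f l (y + u) <=
    lagrangian f l y + D u + L / 2 * dotprod u u.
  have fi i : f i (row i (y + u)) <= f i (row i y)
      + dotprod (gradient (f i) (row i y)) (row i u)
      + L / 2 * dotprod (row i u) (row i u).
    rewrite linearD -derive_gradient//.
    apply: (le_trans (descent_lemma _ _ (f_diff i) (f_smooth i))).
    by rewrite lerD2l ler_wpM2r ?dotprodv_ge0// ler_pM2r.
  have := ler_sum (index_enum _) (fun i (_ : true) => fi i).
  rewrite /lagrangian consensus_opD dotprodDr !big_split /= -mulr_sumr.
  by rewrite -dotprod_row /D; lra.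
suff : 0 <= - D v by have := upper v; lra.
apply: (@affine_ge0 _ _ (L / 2 * dotprod v v)) => t /andP[t0 _].
rewrite -(pmulr_rge0 _ t0); have := upper (- t *: v).
have := ymin (y - t *: v); rewrite scaleNr.
by rewrite -scaleNr DZ dotprodZl dotprodZr; nra.
Qed.

Lemma strong_le_smooth l y :
  (forall z, lagrangian f l y <= lagrangian f l z) -> mu <= L.
Proof.
move=> ymin; pose v : 'M[R]_(m, n) := const_mx 1.
have vv : 0 < dotprod v v.
  have -> : dotprod v v = (m * n)%:R.
    rewrite /dotprod; under eq_bigr do under eq_bigr do rewrite !mxE mulr1.
    by rewrite !sumr_const !card_ord -mulrnA mulnC.
  by rewrite ltr0n muln_gt0 hn ltnW.
have := lagrangian_argmin_growth v ymin.
have := lagrangian_argmin_descent v ymin; nra.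
Qed.

Lemma dual_fun_argmin l y : is_argmin (block_set setT) (lagrangian f l) y ->
  dual_fun setT f l = (lagrangian f l y)%:E.
Proof.
move=> [yD ymin]; apply/le_anti/andP; split.
  by apply: ereal_inf_lbound; exists y.
by apply: le_ereal_inf_tmp => _ [z zD <-]; rewrite lee_fin; exact: ymin.
Qed.

Lemma dual_smooth l l' y z :
  (forall z, lagrangian f l y <= lagrangian f l z) ->
  lagrangian f l y + dotprod (l' - l) (consensus_op y)
    - (1 / mu * (2 + 2 * cos (pi / m%:R))) / 2 * dotprod (l' - l) (l' - l)
  <= lagrangian f l' z.
Proof.
move=> ymin; rewrite -(subrKC y z); move: (z - y) => v.
have := lagrangian_argmin_growth v ymin.
rewrite (lagrangianDl l l') consensus_opD.
move: (l' - l) => w; rewrite dotprodDr; pose u := consensus_adj w.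
rewrite [dotprod w (consensus_op v)]consensus_adjP// -/u.
have /andP[_ ub] := consensus_adj_bounds hm w.
have young : 0 <= mu / 2 * dotprod v v + dotprod u v + dotprod u u / (2 * mu).
  have -> : mu / 2 * dotprod v v + dotprod u v + dotprod u u / (2 * mu) =
      dotprod (u + mu *: v) (u + mu *: v) / (2 * mu).
    rewrite dotprodDl !dotprodDr !dotprodZl !dotprodZr (dotprodC v u).
    by field; rewrite gt_eqF.
  by rewrite divr_ge0 ?dotprodv_ge0// mulr_ge0// ltW.
have : dotprod u u / (2 * mu) <=
    (1 / mu * (2 + 2 * cos (pi / m%:R))) / 2 * dotprod w w.
  rewrite ler_pdivrMr ?mulr_gt0//.
  have -> // : 1 / mu * (2 + 2 * cos (pi / m%:R)) / 2 * dotprod w w * (2 * mu)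
      = (2 + 2 * cos (pi / m%:R)) * dotprod w w.
  by field; rewrite gt_eqF.
lra.
Qed.

(* Polyak-Lojasiewicz inequality, proved without a primal minimizer for [l']:
   it suffices to test the infimum at one gradient-like step from [y]. *)
Lemma dual_gradient_domination l l' y :
  let mu_h := 1 / L * (2 - 2 * cos (pi / m%:R)) in
  (forall z, lagrangian f l y <= lagrangian f l z) ->
  exists z, lagrangian f l' z <= lagrangian f l y
    + dotprod (consensus_op y) (consensus_op y) / (2 * mu_h).
Proof.
move=> mu_h ymin; pose u := consensus_adj (l' - l).
have mu_h_gt0 : 0 < mu_h.
  have /andP[_ c1] := cos_pi_div_bounds R hm.
  by rewrite mulr_gt0 ?divr_gt0// subr_gt0; lra.
exists (y + - L^-1 *: u).
have := lagrangian_argmin_descent (- L^-1 *: u) ymin.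
rewrite (lagrangianDl l l') consensus_opD /u.
move: (l' - l) => w {u}; rewrite dotprodDr; pose u := consensus_adj w.
rewrite [dotprod w (consensus_op (_ *: u))]consensus_adjP// -/u.
rewrite dotprodZl !dotprodZr.
have /andP[lb _] := consensus_adj_bounds hm w.
set q := consensus_op y.
have young : dotprod w q <= mu_h / 2 * dotprod w w + dotprod q q / (2 * mu_h).
  rewrite -subr_ge0.
  have -> : mu_h / 2 * dotprod w w + dotprod q q / (2 * mu_h) - dotprod w q =
      dotprod (q - mu_h *: w) (q - mu_h *: w) / (2 * mu_h).
    rewrite dotprodDl !dotprodDr !dotprodNl !dotprodNr !dotprodZl !dotprodZr.
    by rewrite (dotprodC q w); field; rewrite gt_eqF.
  by rewrite divr_ge0 ?dotprodv_ge0// mulr_ge0// ltW.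
have : mu_h / 2 * dotprod w w <= L^-1 / 2 * dotprod u u.
  have -> : mu_h / 2 * dotprod w w =
      L^-1 / 2 * ((2 - 2 * cos (pi / m%:R)) * dotprod w w).
    by rewrite /mu_h; field; rewrite gt_eqF.
  by rewrite ler_pM2l// divr_gt0// invr_gt0.
have -> : L / 2 * (- L^-1 * (- L^-1 * dotprod u u)) = L^-1 / 2 * dotprod u u.
  by field; rewrite gt_eqF.
lra.
Qed.

End Lagrangian.

Section Contraction.
Variables (R : realType) (F s : nat -> R).
Hypothesis s_le1 : forall k, s k <= 1.
Hypothesis F_contract : forall k, F k.+1 <= (1 - s k) * F k.

Lemma contraction_expR k : F k <= `|F 0%N| * expR (- series s k).
Proof.
elim: k => [|k IH].
  by rewrite /series /= big_geq// oppr0 expR0 mulr1 ler_norm.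
rewrite (le_trans (F_contract k))//.
rewrite (le_trans (ler_wpM2l _ IH)) ?subr_ge0//.
rewrite /series /= big_nat_recr//= opprD expRD mulrCA ler_wpM2l//.
by rewrite mulrC ler_wpM2l ?expR_ge0// expR_ge1Dx.
Qed.

Lemma contraction_eventually_le (d : R) : 0 < d ->
  series s @ \oo --> +oo -> \forall k \near \oo, F k <= d.
Proof.
move=> d0 soo.
have Fd : 0 < `|F 0%N| + 1 by rewrite ltr_wpDl.
near=> k; rewrite (le_trans (contraction_expR k))//.
have sk : - ln (d / (`|F 0%N| + 1)) <= series s k.
  by near: k; exact: (cvgry_ge soo).
have : expR (- series s k) <= d / (`|F 0%N| + 1).
  by rewrite -[leRHS]lnK ?posrE ?divr_gt0// ler_expR lerNl.
move=> h; apply: (@le_trans _ _ ((`|F 0%N| + 1) * expR (- series s k))).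
  by rewrite ler_wpM2r ?expR_ge0// lerDl.
by rewrite mulrC -ler_pdivlMr.
Unshelve. all: by end_near. Qed.

(* [1 - a / x <= expR (- a / x)] and [(1 + 1 / x) `^ a <= expR (a / x)]. *)
Lemma powR_decay_step (a x : R) : 0 < a -> 0 < x ->
  (1 - a / x) / x `^ a <= ((x + 1) `^ a)^-1.
Proof.
move=> a0 x0.
have x1 : 0 < x + 1 by rewrite addr_gt0.
have xa : (x + 1) `^ a <= x `^ a * expR (a / x).
  have -> : x + 1 = x * (1 + x^-1) by field; rewrite gt_eqF.
  have i0 : 0 <= 1 + x^-1 by rewrite addr_ge0// invr_ge0 ltW.
  rewrite powRM ?(ltW x0)// ler_wpM2l ?powR_ge0// [a / x]mulrC expRM.
  by rewrite ge0_ler_powR ?nnegrE ?expR_ge0 ?(ltW a0)// expR_ge1Dx.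
rewrite ler_pdivrMr ?powR_gt0// ler_pdivlMl ?powR_gt0//.
have [a1|a1] := leP (1 - a / x) 0.
  by rewrite (@le_trans _ _ 0) ?powR_ge0// mulr_ge0_le0 ?powR_ge0.
rewrite (le_trans (ler_wpM2r (ltW a1) xa))// -mulrA ger_pMr ?powR_gt0//.
rewrite -[leRHS](expRxMexpNx_1 (a / x)) ler_wpM2l ?expR_ge0//.
exact: expR_ge1Dx.
Qed.

Lemma contraction_powR (c p : R) : 0 < p -> p <= 1 -> 0 < c ->
  (forall k, s k = c / k.+1%:R `^ p) ->
  exists C : R, \forall k \near \oo, F k <= C / k%:R `^ (c / p).
Proof.
move=> p0 p1 c0 sE; set a := c / p.
have a0 : 0 < a by rewrite divr_gt0.
have [K sK] : exists K, forall k, (K <= k)%N -> a / k.+1%:R <= s k.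
  have [K hK] : exists K, forall k, (K <= k)%N -> k.+1%:R `^ p <= p * k.+1%:R.
    have [->|pn1] := eqVneq p 1.
      by exists 0%N => k _; rewrite powRr1// mul1r.
    have q0 : 0 < 1 - p by rewrite subr_gt0 lt_neqAle pn1.
    have [K _ hK] := nbhs_infty_ger (p^-1 `^ (1 - p)^-1).
    exists K => k /hK /= kX.
    have : p^-1 <= k.+1%:R `^ (1 - p).
      have -> : p^-1 = (p^-1 `^ (1 - p)^-1) `^ (1 - p).
        by rewrite -powRrM mulVf ?gt_eqF// powRr1// invr_ge0 ltW.
      rewrite ge0_ler_powR ?nnegrE ?powR_ge0 ?(ltW q0)//.
      by rewrite (le_trans kX)// ler_nat.
    rewrite -(ler_pM2l p0) divff ?gt_eqF// => h.
    rewrite -[leLHS]mulr1.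
    rewrite (le_trans (ler_wpM2l (powR_ge0 _ _) h))// mulrCA -powRD ?subrKC.
      by rewrite powRr1.
    by rewrite pnatr_eq0 implybT.
  exists K => k /hK h; rewrite sE /a -mulrA ler_pM2l//.
  by rewrite -invfM lef_pV2 ?posrE ?mulr_gt0 ?powR_gt0.
pose C := `|F K| * K.+1%:R `^ a.
have C0 : 0 <= C by rewrite mulr_ge0// powR_ge0.
have FC j : F (K + j)%N <= C / (K + j).+1%:R `^ a.
  elim: j => [|j IH].
    by rewrite addn0 /C mulfK ?ler_norm// gt_eqF// powR_gt0.
  rewrite addnS (le_trans (F_contract _))//.
  rewrite (le_trans (ler_wpM2l _ IH)) ?subr_ge0//.
  have := powR_decay_step a0 (ltr0Sn R (K + j)); rewrite natr1 => h.
  rewrite mulrCA ler_wpM2l// (le_trans _ h)// ler_wpM2r ?invr_ge0 ?powR_ge0//.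
  by rewrite lerD2l lerN2 sK// leq_addr.
exists C; exists K.+1 => // k /= Kk.
have -> : k = (K + (k - K))%N by rewrite subnKC// ltnW.
rewrite (le_trans (FC _))// subnKC ?(ltnW Kk)// ler_wpM2l//.
have k0 : 0 < k%:R :> R by rewrite ltr0n (leq_trans _ Kk).
rewrite lef_pV2 ?posrE ?powR_gt0// ge0_ler_powR ?nnegrE ?(ltW a0)//.
by rewrite ler_nat.
Qed.

End Contraction.

Lemma limn_esup_le_near (R : realType) (u : nat -> \bar R) (B : \bar R) :
  (forall d : R, 0 < d -> \forall k \near \oo, (u k <= B + d%:E)%E) ->
  (limn_esup u <= B)%E.
Proof.
move=> h; apply/lee_addgt0Pr => d d0.
apply: le_trans (_ : ereal_sup (u @` [set k | u k <= B + d%:E]%E) <= _)%E.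
  by apply: ereal_inf_lbound; exists [set k | u k <= B + d%:E]%E => //; exact: h.
by apply: ge_ereal_sup => _ [k kA <-].
Qed.

Section InexactDual.
Variables (R : realType) (m n : nat) (f : 'I_m -> 'rV[R]_n -> R).
Variables (mu L : R) (mus Ls : 'I_m -> R).
Hypotheses (hm : (2 <= m)%N) (hn : (1 <= n)%N).
Hypotheses (mu_gt0 : 0 < mu) (mu_le : forall i, mu <= mus i).
Hypotheses (L_gt0 : 0 < L) (Ls_le : forall i, Ls i <= L).
Hypothesis f_strong : forall i, strongly_convex (mus i) (f i).
Hypothesis f_diff : forall i x, differentiable (f i) x.
Hypothesis f_smooth : forall i, lipschitz_gradient (Ls i) (f i).
Let L_h := 1 / mu * (2 + 2 * cos (pi / m%:R)).
Let mu_h := 1 / L * (2 - 2 * cos (pi / m%:R)).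

Lemma dual_constants_gt0 : 0 < L_h /\ 0 < mu_h.
Proof.
have /andP[c0 c1] := cos_pi_div_bounds R hm.
by split; rewrite mulr_gt0 ?divr_gt0 ?subr_gt0//; lra.
Qed.

Lemma dual_condition_le1 (l : 'M[R]_(m.-1, n)) (y : 'M[R]_(m, n)) :
  (forall z, lagrangian f l y <= lagrangian f l z) -> mu_h <= L_h.
Proof.
move=> /(strong_le_smooth hm hn mu_le Ls_le f_strong f_diff f_smooth).
have /andP[c0 c1] := cos_pi_div_bounds R hm => muL.
by rewrite /mu_h /L_h !div1r ler_pM ?invr_ge0 ?(ltW L_gt0) ?lef_pV2//; lra.
Qed.

(* With [gamma <= 1 / L_h], the error term [L_h / 2 * gamma ^+ 2 * |q + d|^2]
   of the ascent step is at most [gamma / 2 * |q + d|^2], and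
   [<q, q + d> - |q + d|^2 / 2 = |q|^2 / 2 - |d|^2 / 2]. *)
Lemma inexact_dual_step (gamma gs eps : R) (l l' : 'M[R]_(m.-1, n))
    (y y' r : 'M[R]_(m, n)) :
  (forall z, lagrangian f l y <= lagrangian f l z) ->
  l' = l + gamma *: consensus_op (y + r) ->
  0 < gamma <= 1 / L_h ->
  dotprod (consensus_op r) (consensus_op r) <= eps ^+ 2 ->
  gs <= lagrangian f l y
    + dotprod (consensus_op y) (consensus_op y) / (2 * mu_h) ->
  gs - lagrangian f l' y' - eps ^+ 2 / (2 * mu_h) <=
    (1 - mu_h * gamma) * (gs - lagrangian f l y - eps ^+ 2 / (2 * mu_h)).
Proof.
move=> ymin -> /andP[g0 gL]; have [L_h0 mu_h0] := dual_constants_gt0.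
have := dual_smooth hm mu_gt0 mu_le f_strong
  (l + gamma *: consensus_op (y + r)) y' ymin.
rewrite [_ + _ - l]addrC addKr -/L_h consensus_opD !dotprodZl !dotprodZr.
set q := consensus_op y; set d := consensus_op r.
rewrite !dotprodDl !dotprodDr (dotprodC d q).
set G := lagrangian f l y; set G' := lagrangian f _ y'.
set qq := dotprod q q; set qd := dotprod q d; set dd := dotprod d d.
have nqd : 0 <= qq + qd + (qd + dd).
  have := dotprodv_ge0 (q + d); rewrite dotprodDl !dotprodDr (dotprodC d q).
  by rewrite -/qq -/qd -/dd; lra.
move=> smooth dd_le pl.
have gL1 : L_h * gamma <= 1 by rewrite mulrC -ler_pdivlMr.
have step : L_h / 2 * (gamma * (gamma * (qq + qd + (qd + dd)))) <=
    gamma / 2 * (qq + qd + (qd + dd)).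
  have -> : L_h / 2 * (gamma * (gamma * (qq + qd + (qd + dd)))) =
    (L_h * gamma) * (gamma / 2 * (qq + qd + (qd + dd))) by ring.
  by rewrite ler_piMl// mulr_ge0// divr_ge0// ltW.
have PL : mu_h * gamma * (gs - G) <= gamma / 2 * qq.
  have -> : gamma / 2 * qq = mu_h * gamma * (qq / (2 * mu_h)).
    by field; rewrite gt_eqF.
  by rewrite (ler_pM2l (mulr_gt0 mu_h0 g0)) lerBlDl.
have dist : gamma / 2 * dd <= mu_h * gamma * (eps ^+ 2 / (2 * mu_h)).
  have -> : mu_h * gamma * (eps ^+ 2 / (2 * mu_h)) = gamma / 2 * eps ^+ 2.
    by field; rewrite gt_eqF.
  by rewrite ler_pM2l// divr_gt0.
lra.
Qed.

End InexactDual.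

Theorem corollary3 (R : realType) (m n : nat)
    (hm : (2 <= m)%N) (hn : (1 <= n)%N)
    (f : 'I_m -> 'rV[R]_n -> R) (mus Ls : 'I_m -> R)
    (f_strict : forall i, strictly_convex (f i))
    (f_closed : forall i, closed_function (f i))
    (mus_gt0 : forall i, 0 < mus i)
    (f_strong : forall i, strongly_convex (mus i) (f i))
    (Ls_gt0 : forall i, 0 < Ls i)
    (f_diff : forall i x, differentiable (f i) x)
    (f_smooth : forall i, lipschitz_gradient (Ls i) (f i))
    (lamstar : 'M[R]_(m.-1, n)) (gamma : nat -> R)
    (r y : nat -> 'M[R]_(m, n)) (lam : nat -> 'M[R]_(m.-1, n))
    (e : 'I_m -> R) :
  let mu := family_min hm mus in
  let L := family_max hm Ls in
  let L_h := (1 / mu) * (2 + 2 * cos (pi / m%:R)) in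
  let mu_h := (1 / L) * (2 - 2 * cos (pi / m%:R)) in
  let g := dual_fun setT f in
  let h := fun l => (- g l)%E in
  let eps := total_distortion e in
  (forall l, (g l <= g lamstar)%E) ->
  inexact_dual_algorithm setT f gamma r y lam ->
  (forall i k, enorm (row i (r k)) <= e i) ->
  (forall k, 0 < gamma k /\ gamma k <= 1 / L_h) ->
  series gamma @ \oo --> +oo ->
  (limn_esup (fun k => (h (lam k) - h lamstar)%E)
     <= (eps ^+ 2 / (2 * mu_h))%:E)%E
  /\
  (forall p c : R, 0 < p -> p <= 1 -> 0 < c -> c <= mu_h / L_h ->
     (forall k : nat, gamma k = (c / mu_h) / (k.+1%:R `^ p)) ->
     exists C : R, \forall k \near \oo,
       (h (lam k) - h lamstar
          <= (C / (k%:R `^ (c / p)) + eps ^+ 2 / (2 * mu_h))%:E)%E).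
Proof.
move=> mu L L_h mu_h g h eps gmax alg re gamma_le gamma_oo.
have mu_le i : mu <= mus i by exact: bigmin_le.
have mu_gt0 : 0 < mu by apply/bigmin_gtP; split.
have Ls_le i : Ls i <= L by exact: le_bigmax.
have L_gt0 : 0 < L.
  exact: lt_le_trans (Ls_gt0 (Ordinal (ltnW hm))) (Ls_le _).
have ymin k z : lagrangian f (lam k) (y k) <= lagrangian f (lam k) z.
  by have [[_ +] _] := alg k; apply.
have [L_h0 mu_h0] := dual_constants_gt0 hm mu_gt0 L_gt0.
have mu_hL : mu_h <= L_h.
  exact: (dual_condition_le1 hm hn mu_gt0 mu_le L_gt0 Ls_le f_strong f_diff
    f_smooth (ymin 0%N)).
have gE k : g (lam k) = (lagrangian f (lam k) (y k))%:E.
  by have [+ _] := alg k; exact: dual_fun_argmin.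
have g_le z : (g lamstar <= (lagrangian f lamstar z)%:E)%E.
  by apply: ereal_inf_lbound; exists z.
have [gs gsE] : exists gs, g lamstar = gs%:E.
  have := gmax (lam 0%N); have := g_le 0; rewrite gE.
  by case: (g lamstar) => [gs||] //; exists gs.
pose B := eps ^+ 2 / (2 * mu_h).
pose F k := gs - lagrangian f (lam k) (y k) - B.
have hE k : (h (lam k) - h lamstar)%E = (F k + B)%:E.
  rewrite /h gE gsE /F -!EFinN -EFinD; congr EFin; ring.
pose s k := mu_h * gamma k.
have s_le1 k : s k <= 1.
  have [g0 gL] := gamma_le k.
  rewrite (le_trans (ler_wpM2l (ltW mu_h0) gL))// [1 / L_h]div1r.
  by rewrite -[leRHS](@divff _ L_h) ?gt_eqF// ler_pM2r ?invr_gt0.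
have F_contract k : F k.+1 <= (1 - s k) * F k.
  have [_ lamS] := alg k; have [g0 gL] := gamma_le k.
  apply: (inexact_dual_step hm mu_gt0 mu_le L_gt0 f_strong (y k.+1)
    (ymin k) lamS).
  - by rewrite g0.
  - by apply: consensus_distortion => i; exact: re.
  - have [z zl] := dual_gradient_domination hm L_gt0 Ls_le f_diff
      f_smooth lamstar (ymin k).
    by rewrite -lee_fin -gsE (le_trans (g_le z))// lee_fin.
split.
  apply: limn_esup_le_near => d d0.
  have s_oo : series s @ \oo --> +oo.
    apply/cvgryPge => A.
    apply: filterS (cvgry_ge gamma_oo (mu_h^-1 * A)) => k; rewrite ler_pdivrMl// => /le_trans; apply.
    by rewrite /series /= mulr_sumr.
  apply: filterS (contraction_eventually_le s_le1 F_contract d0 s_oo) => k Fk.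
  by rewrite hE -EFinD lee_fin addrC lerD2l.
move=> p c p0 p1 c0 _ gammaE.
have sE k : s k = c / k.+1%:R `^ p.
  by rewrite /s gammaE mulrA; congr (_ / _); rewrite mulrC divfK// gt_eqF.
have [C FC] := contraction_powR s_le1 F_contract p0 p1 c0 sE.
by exists C; apply: filterS FC => k Fk; rewrite hE lee_fin lerD2r.
Qed.
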